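(* Let $R$ be a commutative ring with identity, $M$ an $R$-module, and $P$ a submodule of $M$ with $(P:_R M)\subseteq \mathrm{Jac}(R)$, where $\mathrm{Jac}(R)$ is the Jacobson radical of $R$. Then the following statements are equivalent: (a) $P$ is a primary submodule of $M$. (b) $(P:_R M)$ is a primary ideal of $R$ and $P$ is an $(R-\mathfrak{m})$-primary submodule of $M$ for each $\mathfrak{m}\in \mathrm{Max}(R)$.
   Context: All rings are commutative with identity and all modules are unital. $\mathrm{Max}(R)$ is the set of maximal ideals of $R$. A multiplicatively closed subset $S$ of $R$ is a non-empty subset with $0\notin S$, $1\in S$, and $ss'\in S$ for all $s,s'\in S$; $R-\mathfrak{m}$ (set complement) is such a subset for each $\mathfrak m\in\mathrm{Max}(R)$. $(P:_R M)=\{r\in R : rM\subseteq P\}$, and $\sqrt{I}$ is the radical of an ideal $I$. A submodule $P$ of $M$ with $(P:_R M)\cap S=\emptyset$ is called $S$-primary if there exists $s\in S$ such that whenever $rm\in P$ with $r\in R$, $m\in M$, then $sr\in\sqrt{(P:_R M)}$ or $sm\in P$. A submodule $P$ of $M$ is primary if $P\ne M$ and whenever $rm\in P$ with $r\in R$, $m\in M$, then $r\in\sqrt{(P:_R M)}$ or $m\in P$. *)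

(* Defs.v *)
From HB Require Import structures.
From mathcomp Require Import all_boot all_algebra.
From mathcomp Require Import boolp classical_sets.

Set Implicit Arguments.
Unset Strict Implicit.
Unset Printing Implicit Defensive.

Import GRing.Theory.
Local Open Scope classical_set_scope.
Local Open Scope ring_scope.

Definition is_submodule (R : comPzRingType) (M : lmodType R) (P : set M) : Prop :=
  GRing.submod_closed (mem P).

(* Not necessarily proper, unlike the library's [idealr_closed]. *)
Definition is_ideal (R : comPzRingType) (I : set R) : Prop :=
  @is_submodule R R^o I.

(* (P :_R M) = {r | r M <= P} *)
Definition colon (R : comPzRingType) (M : lmodType R) (P : set M) : set R :=
  [set r | forall x : M, P (r *: x)].

Definition radical (R : comPzRingType) (I : set R) : set R :=
  [set r | exists2 n, (0 < n)%N & I (r ^+ n)].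

Definition Max (R : comPzRingType) : set (set R) :=
  [set m | [/\ is_ideal m, m <> setT &
    forall J : set R, is_ideal J -> m `<=` J -> J = m \/ J = setT]].
Arguments Max R : clear implicits.

(* The empty intersection, for R the zero ring, is R. *)
Definition Jac (R : comPzRingType) : set R := \bigcap_(m in Max R) m.
Arguments Jac R : clear implicits.

Definition mult_closed (R : comPzRingType) (S : set R) : Prop :=
  [/\ ~ S 0, S 1 & forall s t : R, S s -> S t -> S (s * t)].

Definition primary_ideal (R : comPzRingType) (I : set R) : Prop :=
  [/\ is_ideal I, I <> setT &
    forall a b : R, I (a * b) -> radical I a \/ I b].

Definition primary_submodule (R : comPzRingType) (M : lmodType R)
    (P : set M) : Prop :=
  [/\ is_submodule P, P <> setT &
    forall (r : R) (x : M), P (r *: x) -> radical (colon P) r \/ P x].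

(* Meant for multiplicatively closed S; see [mult_closed_setC_Max]. *)
Definition S_primary_submodule (R : comPzRingType) (M : lmodType R)
    (S : set R) (P : set M) : Prop :=
  [/\ is_submodule P, colon P `&` S = set0 &
    exists2 s : R, S s &
      forall (r : R) (x : M), P (r *: x) ->
        radical (colon P) (s * r) \/ P (s *: x)].

Lemma is_submoduleP (R : comPzRingType) (M : lmodType R) (P : set M) :
  is_submodule P <->
  P 0 /\ forall (a : R) (u v : M), P u -> P v -> P (a *: u + v).
Proof.
split=> -[P0 PD]; split.
- by move: P0; rewrite inE.
- move=> a u v Pu Pv; have := PD a u v; rewrite !inE; exact.
- by rewrite inE.
- by move=> a u v; rewrite !inE; apply: PD.
Qed.

Lemma mult_closed_setC_Max (R : comPzRingType) (m : set R) :
  Max R m -> mult_closed (~` m).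
Proof.
move=> [/is_submoduleP[m0 mD] mT mmax].
have mM a u : m u -> m (a * u).
  by move=> mu; have := mD a _ _ mu m0; rewrite addr0.
have m1 : ~ m 1.
  move=> m1; apply: mT; apply/seteqP; split=> // x _.
  by have := mM x _ m1; rewrite mulr1.
split=> [|//|s t ms mt mst]; first by apply.
pose J : set R := [set x | exists c, m (x - c * s)].
have J_id : is_ideal J.
  apply/is_submoduleP; split=> [|a u v [c mc] [d md]].
    by exists 0; rewrite mul0r subr0.
  exists (a * c + d).
  suff -> : (a *: (u : R^o) + v) - (a * c + d) * s
            = a * (u - c * s) + (v - d * s) by exact: mD.
  by rewrite mulrDl opprD mulrBr mulrA addrACA.
have mJ : m `<=` J by move=> x mx; exists 0; rewrite mul0r subr0.
have Js : J s by exists 1; rewrite mul1r subrr.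
case: (mmax J J_id mJ) => [eJ|eJ]; first by apply: ms; rewrite -eJ.
have [c mc] : J 1 by rewrite eJ.
apply: mt; have -> : t = t * (1 - c * s) + c * (s * t).
  by rewrite mulrBr mulr1 mulrA (mulrC _ t) mulrA subrK.
apply: (mD t _ _ mc); exact: mM.
Qed.

(* Main.v *)
Require Import Defs.
From HB Require Import structures.
From mathcomp Require Import all_boot all_algebra.
From mathcomp Require Import boolp classical_sets.
Local Open Scope classical_set_scope.
Local Open Scope ring_scope.

(**
For (b) => (a), let r x lie in P with r outside the radical of (P : M).  At each
maximal ideal m the witness s outside m of (R - m)-primariness satisfies s x in
P: otherwise a power of s r lies in (P : M), hence a power of s does since
(P : M) is a primary ideal, and (P : M) <= Jac(R) <= m puts s in m.  So the
ideal {a | a x in P} is contained in no maximal ideal and contains 1.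
*)

Set Implicit Arguments.
Unset Strict Implicit.
Import GRing.Theory.

Lemma is_ideal_neq_setT (R : comPzRingType) (I : set R) :
  is_ideal I -> I <> setT <-> ~ I 1.
Proof.
move=> /is_submoduleP[I0 ID]; split=> [IT I1|I1 IT]; last by apply: I1; rewrite IT.
apply: IT; apply/seteqP; split=> // a _.
by have := ID a _ _ I1 I0; rewrite addr0 [_ *: _]mulr1.
Qed.

(** Zorn's lemma applies to the sets [X] whose union with [I] is a proper ideal: if [A] is maximal
    among them, the union of [I] and [A] is the maximal ideal sought. *)
Lemma ideal_sub_Max (R : comPzRingType) (I : set R) :
  is_ideal I -> ~ I 1 -> exists2 m, Max R m & I `<=` m.
Proof.
move=> I_ideal I1.
(* Adjoining I makes the predicate hold of the empty union as well. *)
pose Q := [set X : set R | is_ideal (I `|` X) /\ ~ (I `|` X) 1].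
have [A []] : exists A, Q A /\ forall B, A `<` B -> ~ Q B.
  apply: Zorn_bigcup => F FQ Ftot.
  have [I0 ID] := iffLR (is_submoduleP _) I_ideal.
  have FD X : F X -> forall (a u v : R), (I `|` X) u -> (I `|` X) v ->
      (I `|` X) (a *: (u : R^o) + v).
    by move=> /FQ[/is_submoduleP[_ XD] _]; exact: XD.
  have sub X u : F X -> (I `|` X) u -> (I `|` \bigcup_(Y in F) Y) u.
    by move=> FX [?|?]; [left | right; exists X].
  split; last by case=> // -[X FX X1]; case: (FQ X FX) => _; apply; right.
  apply/is_submoduleP; split=> [|a u v]; first by left.
  move=> [Iu|[X FX Xu]] [Iv|[Y FY Yv]].
  - by left; apply: ID.
  - by apply: (sub Y) => //; apply: FD => //; [left | right].
  - by apply: (sub X) => //; apply: FD => //; [right | left].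
  (* The chain condition puts both elements in the larger of the two sets. *)
  - have [XY|YX] := Ftot _ _ FX FY.
    + by apply: (sub Y) => //; apply: FD => //; right => //; apply: XY.
    + by apply: (sub X) => //; apply: FD => //; right => //; apply: YX.
move=> [IA_ideal IA1] Amax; exists (I `|` A); last by move=> x; left.
split=> // [|J J_ideal IAJ]; first exact/(is_ideal_neq_setT IA_ideal).
have [JT|JT] := pselect (J = setT); [by right | left].
have IJ : I `|` J = J by apply/setUidPr => x Ix; apply: IAJ; left.
apply/seteqP; split=> // x Jx; apply: contrapT => IAx.
(* A proper [J] containing [I] satisfies [Q], and [x] makes it strictly larger than [A]. *)
apply: (Amax J).
  split=> [y Ay|JA]; first by apply: IAJ; right.
  by apply: IAx; right; apply: JA.
split; rewrite IJ //.
exact: (iffLR (is_ideal_neq_setT J_ideal)).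
Qed.

Lemma colon_is_ideal (R : comPzRingType) (M : lmodType R) (P : set M) :
  is_submodule P -> is_ideal (colon P).
Proof.
move=> /is_submoduleP[P0 PD]; apply/is_submoduleP.
split=> [x|a u v Pu Pv x]; first by rewrite scale0r.
by rewrite scalerDl [a *: _]/(a * u) -scalerA; apply: PD.
Qed.

Lemma colon_eq_setT (R : comPzRingType) (M : lmodType R) (P : set M) :
  is_submodule P -> colon P = setT <-> P = setT.
Proof.
move=> /is_submoduleP[P0 PD]; split=> [cT|->]; last exact/seteqP.
apply/seteqP; split=> // x _; rewrite -[x]scale1r.
by have : colon P 1 by rewrite cT.
Qed.

(** Primariness of [P] is applied to [a] and each vector [b *: x]: if [a] is outside the radical,
    every [b *: x] lies in [P]. *)
Lemma primary_colon (R : comPzRingType) (M : lmodType R) (P : set M) :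
  primary_submodule P -> primary_ideal (colon P).
Proof.
move=> [P_sub PT Pprim]; split=> [||a b Pab]; first exact: colon_is_ideal.
  by rewrite colon_eq_setT.
have [ra|nra] := pselect (radical (colon P) a); [by left | right=> x].
by have := Pab x; rewrite -scalerA => /Pprim[].
Qed.

Lemma mult_closedX (R : comPzRingType) (S : set R) (s : R) (n : nat) :
  mult_closed S -> S s -> S (s ^+ n).
Proof.
move=> [_ S1 SM] Ss; elim: n => [|n IHn]; first by rewrite expr0.
by rewrite exprS; apply: SM.
Qed.

Lemma primary_ideal_radicalM (R : comPzRingType) (I S : set R) (s r : R) :
  mult_closed S -> primary_ideal I -> I `&` S = set0 -> S s ->
  radical I (s * r) -> radical I r.
Proof.
(* Primariness puts the first factor in the radical or the second in [I]. With [r ^+ n] first, the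
   bad case is [s ^+ n] in [I], which disjointness from [S] excludes. *)
move=> S_mult [_ _ Iprim] IS Ss [n n_gt0]; rewrite mulrC exprMn.
move=> /Iprim[[k k_gt0]|Isn].
  by rewrite -exprM => Irnk; exists (n * k)%N => //; rewrite muln_gt0 n_gt0.
have : (I `&` S) (s ^+ n) by split=> //; apply: mult_closedX.
by rewrite IS.
Qed.

Theorem theorem2p25 (R : comPzRingType) (M : lmodType R) (P : set M)
    (P_submodule : is_submodule P) (colonP_Jac : colon P `<=` Jac R) :
  primary_submodule P <->
  (primary_ideal (colon P) /\
   forall m : set R, Max R m -> S_primary_submodule (~` m) P).
Proof.
split=> [P_prim|[cP_prim P_Sprim]].
  split=> [|m m_max]; first exact: primary_colon.
  have [_ m1 _] := mult_closed_setC_Max m_max.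
  split=> //; first by apply/disjoints_subset; rewrite setCK => r /colonP_Jac; apply.
  (* For the witness 1 the condition is that of a primary submodule. *)
  exists 1 => // r x; rewrite mul1r scale1r.
  by case: P_prim => _ _; apply.
have [P0 PD] := iffLR (is_submoduleP _) P_submodule.
split=> // [PT|r x Prx].
  (* Properness comes from [primary_ideal]: over the zero ring there is no maximal ideal and the
     local condition is vacuous. *)
  by case: cP_prim => _ + _; apply; apply/colon_eq_setT.
have [rr|nrr] := pselect (radical (colon P) r); [by left | right].
pose J : set R := [set a | P (a *: x)].
have J_ideal : is_ideal J.
  apply/is_submoduleP; split=> [|a u v Ju Jv]; rewrite /J /= ?scale0r //.
  by rewrite scalerDl [a *: _]/(a * u) -scalerA; apply: PD.
apply: contrapT => Px.
have [|m m_max Jm] := ideal_sub_Max J_ideal; first by rewrite /J /= scale1r.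
have [_ cPm [s ms sP]] := P_Sprim m m_max.
have [rsr|Psx] := sP r x Prx; last by apply: ms; apply: Jm.
apply: nrr.
exact: primary_ideal_radicalM (mult_closed_setC_Max m_max) cP_prim cPm ms rsr.
Qed.
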